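(* Let $A$ and $B$ be connected graded $k$-algebras finitely generated in degree $1$, and suppose that $Z(A)\cap A_1=\{0\}$. If $A[t_1,\dots,t_n]\cong B[s_1,\dots,s_n]$ as ungraded algebras, then $A\cong B$.
   Context: $Z(A)$ denotes the center of $A$. $A[t_1,\dots,t_n]$ and $B[s_1,\dots,s_n]$ are polynomial extensions in central indeterminates. A connected graded algebra satisfies $A_0=k$; finitely generated in degree $1$ means $\dim_k A_1<\infty$ and $A$ is generated by $A_1$. *)

(* Defs.v *)
From HB Require Import structures.
From mathcomp Require Import all_boot all_order all_algebra.
Set Implicit Arguments. Unset Strict Implicit. Unset Printing Implicit Defensive.
Import GRing.Theory.
Local Open Scope ring_scope.

Definition is_grading (k : fieldType) (A : algType k) (G : nat -> A -> Prop) : Prop :=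
  [/\ (forall i, G i 0),
      (forall i x y, G i x -> G i y -> G i (x + y)) /\
      (forall i (c : k) x, G i x -> G i (c *: x)),
      (forall i j x y, G i x -> G j y -> G (i + j)%N (x * y)),
      (forall a : A, exists N (f : nat -> A),
          (forall i, G i (f i)) /\ a = \sum_(i < N) f i) &
      (forall N (f : nat -> A), (forall i, G i (f i)) ->
          \sum_(i < N) f i = 0 -> forall i, (i < N)%N -> f i = 0)].

Definition cgfg1 (k : fieldType) (A : algType k) (G : nat -> A -> Prop) : Prop :=
  [/\ is_grading G,
      (forall x : A, G 0%N x <-> exists c : k, x = c%:A),
      (exists (m : nat) (v : 'I_m -> A),
          forall x, G 1%N x <-> exists c : 'I_m -> k, x = \sum_(j < m) c j *: v j) &
      (* A is generated by A_1 as a k-algebra *)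
      (forall P : A -> Prop,
          P 1 -> (forall x y, P x -> P y -> P (x + y)) ->
          (forall x y, P x -> P y -> P (x * y)) ->
          (forall (c : k) x, P x -> P (c *: x)) ->
          (forall x, G 1%N x -> P x) -> forall a, P a)].

Fixpoint polyext (R : nzRingType) (n : nat) : nzRingType :=
  if n is m.+1 then ({poly polyext R m} : nzRingType) else R.

Fixpoint embext (R : nzRingType) (n : nat) : R -> polyext R n :=
  match n return R -> polyext R n with
  | 0 => fun a => a
  | m.+1 => fun a => (embext m a)%:P
  end.

(* isomorphism of (ungraded) k-algebras between R and S, where the k-algebra
   structures are given by the structure maps iR : k -> R and iS : k -> S *)
Definition kalg_iso (k : fieldType) (R S : nzRingType)
    (iR : k -> R) (iS : k -> S) (f : R -> S) : Prop :=
  [/\ bijective f,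
      (forall x y, f (x + y) = f x + f y),
      (forall x y, f (x * y) = f x * f y),
      f 1 = 1 &
      (forall c : k, f (iR c) = iS c)].

Definition kmapn (k : fieldType) (A : algType k) (n : nat) : k -> polyext A n :=
  fun c => embext n (c%:A : A).

Definition graded_iso (k : fieldType) (A B : algType k)
    (GA : nat -> A -> Prop) (GB : nat -> B -> Prop) (f : A -> B) : Prop :=
  kalg_iso (fun c : k => c%:A : A) (fun c : k => c%:A : B) f /\
  (forall i x, GA i x <-> GB i (f x)).

(* Main.v *)
Require Import Defs.
From HB Require Import structures.
From mathcomp Require Import all_boot all_order all_algebra.
From mathcomp Require Import boolp zify.
Set Implicit Arguments. Unset Strict Implicit. Unset Printing Implicit Defensive.
Import GRing.Theory.
Local Open Scope ring_scope.

(** Write C = A[t_1, ..., t_n] and D = B[s_1, ..., s_n], graded with the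
    variables in degree 1; both are connected and generated in degree 1.

    An ungraded isomorphism phi : C -> D yields a graded one.  Let
    M_n = phi(C_{>= n}), a multiplicative filtration of D whose associated graded
    algebra is C.  Each u in D_1 differs from an element of M_1 by a scalar, so
    by generation in degree 1 each u in D_n differs from an element of M_n by an
    element of D_{< n}; hence D = D_{< n} + M_n, i.e. D_{< n} maps onto
    D / M_n ~ C_{< n}.  By symmetry C_{< n} maps onto D_{< n}, and as these
    spaces are finite dimensional, D is the direct sum of D_{< n} and M_n.
    Therefore M_n / M_{n+1} ~ M_n /\ D_{<= n} ~ D_n through top components, and
    C ~ gr_M D ~ D as graded algebras.

    The central elements of C_1 form the span of the n elements t_i, since
    Z(A) /\ A_1 = 0.  A graded isomorphism g : C -> D pulls the n independent
    central elements s_j back into this span, so it identifies the spans of the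
    t_i and of the s_j, hence the quotients A and B. *)

(** * Spans and surjective endomorphisms *)

Section LinearAlgebra.
Variables (k : fieldType) (V : lmodType k).

Definition subspace (S : V -> Prop) : Prop :=
  S 0 /\ forall (c : k) x y, S x -> S y -> S (c *: x + y).

Lemma subspace0 S : subspace S -> S 0.
Proof. by case. Qed.

Lemma subspaceD S x y : subspace S -> S x -> S y -> S (x + y).
Proof. by move=> [_ h] Sx Sy; rewrite -[x]scale1r; apply: h. Qed.

Lemma subspaceZ S c x : subspace S -> S x -> S (c *: x).
Proof. by move=> [S0 h] Sx; rewrite -[_ *: _]addr0; apply: h. Qed.

Lemma subspaceB S x y : subspace S -> S x -> S y -> S (x - y).
Proof.
by move=> hS Sx Sy; rewrite -scaleN1r; apply: subspaceD => //; apply: subspaceZ.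
Qed.

Lemma subspace_sum S (I : Type) (r : seq I) (P : pred I) (F : I -> V) :
  subspace S -> (forall i, P i -> S (F i)) -> S (\sum_(i <- r | P i) F i).
Proof.
move=> hS hF; elim/big_ind: _ => //; first by case: hS.
by move=> x y; apply: subspaceD.
Qed.

(** Phrased as the intersection of all subspaces containing [s], so that a hypothesis [spanned s x]
    serves directly as an induction principle. *)
Definition spanned (s : seq V) (x : V) : Prop :=
  forall S, subspace S -> (forall y, y \in s -> S y) -> S x.

Lemma subspace_spanned s : subspace (spanned s).
Proof.
split=> [S [] //|c x y hx hy S hS sS].
by apply: hS.2; [apply: hx | apply: hy].
Qed.

Lemma mem_spanned s x : x \in s -> spanned s x.
Proof. by move=> xs S _; apply. Qed.

Definition lincomb n (v : 'I_n -> V) (c : 'rV[k]_n) : V :=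
  \sum_(j < n) c 0 j *: v j.

Lemma lincomb_is_linear n (v : 'I_n -> V) : linear (lincomb v).
Proof.
move=> a c d; rewrite /lincomb scaler_sumr -big_split; apply: eq_bigr => j _.
by rewrite !mxE scalerDl scalerA.
Qed.
HB.instance Definition _ n (v : 'I_n -> V) :=
  GRing.isLinear.Build k 'rV[k]_n V *:%R (lincomb v) (lincomb_is_linear v).

Lemma lincomb_delta n (v : 'I_n -> V) j : lincomb v (delta_mx 0 j) = v j.
Proof.
rewrite /lincomb (bigD1 j) //= big1 => [|i ij]; rewrite !mxE ?eqxx.
  by rewrite scale1r addr0.
by rewrite (negPf ij) scale0r.
Qed.

Lemma lincomb_mulmx n p (v : 'I_n -> V) (c : 'rV_p) (P : 'M_(p, n)) :
  lincomb v (c *m P) = \sum_(j < p) c 0 j *: lincomb v (row j P).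
Proof.
by rewrite mulmx_sum_row linear_sum; apply: eq_bigr => j _; rewrite linearZ.
Qed.

Lemma spanned_lincomb s x :
  spanned s x -> exists c, x = lincomb (fun j : 'I_(size s) => s`_j) c.
Proof.
move=> sx; apply: (sx (fun y => exists c, y = lincomb _ c)); first split.
- by exists 0; rewrite linear0.
- by move=> c _ _ [d ->] [e ->]; exists (c *: d + e); rewrite linearP.
- move=> y ys; have hy : (index y s < size s)%N by rewrite index_mem.
  by exists (delta_mx 0 (Ordinal hy)); rewrite lincomb_delta nth_index.
Qed.

(** Induction on the size of the spanning family. A dependent family loses a vector; for a free one
    [T] has a matrix, and a one-sided inverse of a square matrix is two-sided. *)
Lemma surjective_endo_injective n (v : 'I_n -> V) (U : V -> Prop)
    (T : {linear V -> V}) :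
    (forall x, U x <-> exists c, x = lincomb v c) ->
    (forall x, U x -> U (T x)) ->
    (forall x, U x -> exists2 y, U y & T y = x) ->
  forall x, U x -> T x = 0 -> x = 0.
Proof.
elim: n v => [|n IHn] v spanU stabU surjU x Ux Tx0.
  by have [c ->] := (spanU x).1 Ux; rewrite /lincomb big_ord0.
have Uv j : U (v j) by apply/spanU; exists (delta_mx 0 j); rewrite lincomb_delta.
have [v_free|] := pselect (forall c, lincomb v c = 0 -> c = 0); last first.
  move/existsNP=> [c /not_implyP[c_rel /eqP/rV0Pn[j cj]]].
  apply: (IHn (v \o lift j)) Ux Tx0 => // y; rewrite spanU; split=> [[d ->]|[d ->]].
    (* Subtracting the multiple of the relation [c] that cancels coordinate [j] removes [v j] from
       the combination. *)
    exists (\row_i (d 0 (lift j i) - d 0 j / c 0 j * c 0 (lift j i))).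
    have -> : lincomb v d = lincomb v (d - (d 0 j / c 0 j) *: c).
      by rewrite linearB linearZ /= c_rel scaler0 subr0.
    rewrite /lincomb (bigD1_ord j) //= !mxE divfK // subrr scale0r add0r.
    by apply: eq_bigr => i _; rewrite !mxE.
  exists (\row_i (if unlift j i is Some i' then d 0 i' else 0)).
  rewrite /lincomb (bigD1_ord j) //= mxE unlift_none scale0r add0r.
  by apply: eq_bigr => i _; rewrite mxE liftK.
have /fin_all_exists[t tE] j : exists c, T (v j) = lincomb v c.
  by apply/spanU/stabU.
have /fin_all_exists[p pE] j : exists c, T (lincomb v c) = v j.
  by have [_ /spanU[c ->] <-] := surjU _ (Uv j); exists c.
(* Coordinates are row vectors, so [T] acts by right multiplication by [M]; the rows of [P] are
   coordinates of preimages of the [v j]. *)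
pose M := \matrix_(j < n.+1) t j; pose P := \matrix_(j < n.+1) p j.
have TM c : T (lincomb v c) = lincomb v (c *m M).
  rewrite lincomb_mulmx linear_sum; apply: eq_bigr => j _.
  by rewrite linearZ rowK -tE.
have PM : P *m M = 1%:M.
  apply/row_matrixP=> j; rewrite row_mul rowK row1.
  apply/eqP; rewrite -subr_eq0; apply/eqP/v_free.
  by rewrite linearB /= -TM pE lincomb_delta subrr.
have [c xE] := (spanU x).1 Ux; move: Tx0; rewrite xE TM => /v_free cM0.
by rewrite -[c]mulmx1 -(mulmx1C PM) mulmxA cM0 mul0mx linear0.
Qed.

End LinearAlgebra.

(** * Homogeneous components and degree bounds *)

Section Grading.
Variables (k : fieldType) (A : algType k) (G : nat -> A -> Prop).
Hypothesis hG : is_grading G.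

Lemma homog_subspace i : subspace (G i).
Proof.
case: hG => G0 [GD GZ] _ _ _; split=> // c x y Gx Gy.
by apply: GD => //; apply: GZ.
Qed.

Lemma homogM i j x y : G i x -> G j y -> G (i + j) (x * y).
Proof. by case: hG => _ _ GM _ _; apply: GM. Qed.

Lemma homog0 i : G i 0. Proof. by case: (homog_subspace i). Qed.

Lemma sum_widen (f : nat -> A) m n : (m <= n)%N ->
  (forall i, (m <= i)%N -> f i = 0) -> \sum_(i < m) f i = \sum_(i < n) f i.
Proof.
move=> mn f0; rewrite (big_ord_widen n) // big_mkcond /=; apply: eq_bigr => i _.
by case: ltnP => // /f0.
Qed.

Lemma decomposition_exists a : exists f : nat -> A,
  (forall i, G i (f i)) /\
  exists n, (forall i, (n <= i)%N -> f i = 0) /\ a = \sum_(i < n) f i.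
Proof.
case: hG => G0 _ _ /(_ a)[n [f [Gf aE]]] _.
exists (fun i => if (i < n)%N then f i else 0); split=> [i|].
  by case: ifP.
exists n; split=> [i|]; first by rewrite leqNgt => /negPf->.
by rewrite aE; apply: eq_bigr => i _; rewrite ltn_ord.
Qed.

(** The family is picked by choice; [hcomp_unique] shows that the choice does not matter. *)
Definition hcomp (i : nat) (a : A) : A := projT1 (cid (decomposition_exists a)) i.

Lemma hcomp_homog i a : G i (hcomp i a).
Proof. by rewrite /hcomp; case: cid => f /= []. Qed.

Lemma hcomp_sum a : exists n,
  (forall i, (n <= i)%N -> hcomp i a = 0) /\ a = \sum_(i < n) hcomp i a.
Proof. by rewrite /hcomp; case: cid => f /= []. Qed.

Lemma hcomp_unique n (f : nat -> A) a i : (forall j, G j (f j)) ->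
  (forall j, (n <= j)%N -> f j = 0) -> a = \sum_(j < n) f j -> hcomp i a = f i.
Proof.
move=> Gf f0 aE; have [m [c0 cE]] := hcomp_sum a.
have [mi|im] := leqP (m + n) i; first by rewrite c0 ?f0 //; lia.
apply/eqP; rewrite -subr_eq0; apply/eqP.
case: hG => _ _ _ _ /(_ (m + n)%N (fun j => hcomp j a - f j)); apply=> // [j|].
  by apply: subspaceB; [apply: homog_subspace | apply: hcomp_homog | ].
rewrite sumrB -(@sum_widen (hcomp^~ a) m) ?leq_addr // -(@sum_widen f n) ?leq_addl //.
by rewrite -cE -aE subrr.
Qed.

Lemma hcomp_is_linear i : linear (hcomp i).
Proof.
move=> c x y; have [m [x0 xE]] := hcomp_sum x; have [n [y0 yE]] := hcomp_sum y.
apply: (@hcomp_unique (m + n) (fun j => c *: hcomp j x + hcomp j y)).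
- by move=> j; apply: (homog_subspace j).2; apply: hcomp_homog.
- by move=> j mnj; rewrite x0 ?y0 ?scaler0 ?addr0 //; lia.
rewrite big_split /= -scaler_sumr -(@sum_widen (hcomp^~ x) m) ?leq_addr //.
by rewrite -(@sum_widen (hcomp^~ y) n) ?leq_addl // -xE -yE.
Qed.
HB.instance Definition _ i :=
  GRing.isLinear.Build k A A *:%R (hcomp i) (hcomp_is_linear i).

Lemma hcomp_of_homog i j x : G i x -> hcomp j x = if j == i then x else 0.
Proof.
move=> Gx; apply: (@hcomp_unique i.+1 (fun l => if l == i then x else 0)).
- by move=> l; case: eqP => [->|_] //; apply: homog0.
- by move=> l; case: eqP => // ->; rewrite ltnn.
rewrite big_ord_recr /= eqxx big1 ?add0r // => l _.
by rewrite ltn_eqF.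
Qed.

Lemma homog_ind (S : A -> Prop) : S 0 -> (forall x y, S x -> S y -> S (x + y)) ->
  (forall i x, G i x -> S x) -> forall a, S a.
Proof.
move=> S0 SD SG a; have [n [_ ->]] := hcomp_sum a.
by elim/big_ind: _ => // i _; apply: SG (hcomp_homog _ _).
Qed.

(** Both sides are additive in each factor, so homogeneous factors suffice; then at most one term of
    the sum is nonzero. *)
Lemma hcompM n x y :
  hcomp n (x * y) = \sum_(j < n.+1) hcomp j x * hcomp (n - j) y.
Proof.
move: x; apply: homog_ind => [|x x' IH IH'|i x Gx].
- by rewrite mul0r raddf0 big1 // => j _; rewrite raddf0 mul0r.
- rewrite mulrDl raddfD /= IH IH' -big_split; apply: eq_bigr => j _.
  by rewrite raddfD mulrDl.
move: y; apply: homog_ind => [|y y' IH IH'|l y Gy].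
- by rewrite mulr0 raddf0 big1 // => j _; rewrite raddf0 mulr0.
- rewrite mulrDr raddfD /= IH IH' -big_split; apply: eq_bigr => j _.
  by rewrite raddfD mulrDr.
rewrite (hcomp_of_homog _ (homogM Gx Gy)).
under eq_bigr do rewrite (hcomp_of_homog _ Gx) (hcomp_of_homog _ Gy).
have [i_n|n_i] := ltnP i n.+1; last first.
  rewrite big1 => [|j _]; first by case: eqP => //; lia.
  by case: eqP; rewrite ?mul0r //; have := ltn_ord j; lia.
rewrite (bigD1 (Ordinal i_n)) //= eqxx big1 => [|j ji].
  rewrite addr0; have -> : (n == i + l)%N = (n - i == l)%N by lia.
  by case: ifP; rewrite ?mulr0.
by case: eqP => [jE|_]; rewrite ?mul0r //; move: ji; rewrite -val_eqE /= jE eqxx.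
Qed.

Definition deg_lt n (x : A) : Prop := forall j, (n <= j)%N -> hcomp j x = 0.
Definition deg_ge n (x : A) : Prop := forall j, (j < n)%N -> hcomp j x = 0.

Lemma deg_lt_subspace n : subspace (deg_lt n).
Proof.
split=> [j _|c x y hx hy j nj]; first exact: raddf0.
by rewrite linearP /= hx ?hy // scaler0 addr0.
Qed.

Lemma deg_ge_subspace n : subspace (deg_ge n).
Proof.
split=> [j _|c x y hx hy j nj]; first exact: raddf0.
by rewrite linearP /= hx ?hy // scaler0 addr0.
Qed.

Lemma deg_ltW m n x : (m <= n)%N -> deg_lt m x -> deg_lt n x.
Proof. by move=> mn h j nj; apply/h/(leq_trans mn). Qed.

Lemma deg_geW m n x : (m <= n)%N -> deg_ge n x -> deg_ge m x.
Proof. by move=> mn h j jm; apply/h/(leq_trans jm). Qed.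

Lemma hcomp_inj x y : (forall i, hcomp i x = hcomp i y) -> x = y.
Proof.
move=> h; apply/eqP; rewrite -subr_eq0; have [n [_ ->]] := hcomp_sum (x - y).
by rewrite big1 // => i _; rewrite raddfB /= h subrr.
Qed.

Lemma homog_of_hcomp n x : (forall j, j != n -> hcomp j x = 0) -> G n x.
Proof.
move=> x0; rewrite (_ : x = hcomp n x); first exact: hcomp_homog.
apply: hcomp_inj => j; rewrite (hcomp_of_homog _ (hcomp_homog _ _)).
by case: eqP => [->|/eqP/x0].
Qed.

Lemma deg_lt_ge_eq0 n x : deg_lt n x -> deg_ge n x -> x = 0.
Proof.
move=> xl xg; apply: hcomp_inj => i; rewrite raddf0.
by have [/xl|/xg] := leqP n i.
Qed.

Lemma homog_deg_lt i n x : (i < n)%N -> G i x -> deg_lt n x.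
Proof. by move=> i_n /hcomp_of_homog xE j nj; rewrite xE; case: eqP => //; lia. Qed.

Lemma homog_deg_ge i n x : (n <= i)%N -> G i x -> deg_ge n x.
Proof. by move=> i_n /hcomp_of_homog xE j nj; rewrite xE; case: eqP => //; lia. Qed.

(** A degree at most [m] plus a degree below [n] is below [m + n]; the asymmetric bounds avoid
    losing one degree. *)
Lemma deg_ltM m n x y : deg_lt m.+1 x -> deg_lt n y -> deg_lt (m + n) (x * y).
Proof.
move=> hx hy j mnj; rewrite hcompM big1 // => l _.
have [lm|ml] := leqP l m; first by rewrite hy ?mulr0 //; lia.
by rewrite hx ?mul0r.
Qed.

Lemma deg_ltM' m n x y : deg_lt m x -> deg_lt n.+1 y -> deg_lt (m + n) (x * y).
Proof.
move=> hx hy j mnj; rewrite hcompM big1 // => l _.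
have [lm|ml] := leqP m l; first by rewrite hx ?mul0r //; lia.
by rewrite hy ?mulr0 //; lia.
Qed.

Lemma deg_geM m n x y : deg_ge m x -> deg_ge n y -> deg_ge (m + n) (x * y).
Proof.
move=> hx hy j mnj; rewrite hcompM big1 // => l _.
have [lm|ml] := ltnP l m; first by rewrite hx ?mul0r.
by rewrite hy ?mulr0 //; have := ltn_ord l; lia.
Qed.

Lemma hcomp_topM m n x y : deg_lt m.+1 x -> deg_lt n.+1 y ->
  hcomp (m + n) (x * y) = hcomp m x * hcomp n y.
Proof.
move=> hx hy; have m_mn : (m < (m + n).+1)%N by lia.
rewrite hcompM (bigD1 (Ordinal m_mn)) //= addKn big1 ?addr0 // => l /eqP lm.
have [l_m|ml] := ltnP m l; first by rewrite hx ?mul0r.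
have ne : (l : nat) <> m by move=> lE; apply: lm; apply/val_inj.
by rewrite hy ?mulr0 //; lia.
Qed.

Definition trunc n (x : A) : A := \sum_(i < n) hcomp i x.

Lemma trunc_is_linear n : linear (trunc n).
Proof.
move=> c x y; rewrite /trunc scaler_sumr -big_split; apply: eq_bigr => i _.
by rewrite linearP.
Qed.
HB.instance Definition _ n :=
  GRing.isLinear.Build k A A *:%R (trunc n) (trunc_is_linear n).

Lemma hcomp_trunc n j x : hcomp j (trunc n x) = if (j < n)%N then hcomp j x else 0.
Proof.
rewrite /trunc raddf_sum /=.
under eq_bigr do rewrite (hcomp_of_homog _ (hcomp_homog _ _)).
case: ltnP => [jn|nj].
  rewrite (bigD1 (Ordinal jn)) //= eqxx big1 ?addr0 // => i /eqP ij.
  by case: eqP => // jE; case: ij; apply/val_inj.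
by rewrite big1 // => i _; case: eqP => //; have := ltn_ord i; lia.
Qed.

Lemma trunc_deg_lt n x : deg_lt n (trunc n x).
Proof. by move=> j nj; rewrite hcomp_trunc ltnNge nj. Qed.

Lemma trunc_id n x : deg_lt n x -> trunc n x = x.
Proof.
by move=> hx; apply: hcomp_inj => i; rewrite hcomp_trunc; case: ltnP => // /hx.
Qed.

Lemma trunc_eq0 n x : deg_ge n x -> trunc n x = 0.
Proof. by move=> hx; apply: big1 => i _; apply: hx. Qed.

End Grading.

Lemma cgfg1_grading (k : fieldType) (A : algType k) (G : nat -> A -> Prop) :
  cgfg1 G -> is_grading G.
Proof. by case. Qed.
Coercion cgfg1_grading : cgfg1 >-> is_grading.

(** * Consequences of generation in degree 1 *)

Section Generation.
Variables (k : fieldType) (A : algType k) (G : nat -> A -> Prop).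
Hypothesis cA : cgfg1 G.
Local Notation hcomp := (hcomp cA).

Lemma homog_scalar c : G 0%N (c%:A).
Proof. by case: cA => _ h _ _; apply/h; exists c. Qed.

Lemma homog1 : G 0%N 1.
Proof. by rewrite -[1]scale1r; apply: homog_scalar. Qed.

Lemma hcomp0E a : exists c, hcomp 0%N a = c%:A.
Proof. by have [_ h _ _] := cA; apply: (h _).1; apply: hcomp_homog. Qed.

(** Generation in degree 1 gives A_{n+1} = A_1 A_n. The induction runs over arbitrary elements, so
    the claim is proved for their component [n.+1], with [n] and [S] left general. *)
Lemma homog_succ_ind n (S : A -> Prop) : subspace S ->
    (forall a b, G 1%N a -> G n b -> S (a * b)) ->
  forall x, G n.+1 x -> S x.
Proof.
move=> hS SM x Gx; have -> : x = hcomp n.+1 x by rewrite (hcomp_of_homog _ _ Gx) eqxx.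
have [_ _ _ genA] := cA; move: x {Gx} n S hS SM; apply: genA.
- by move=> n S [S0 _] _; rewrite (hcomp_of_homog _ _ homog1).
- move=> x y IHx IHy n S hS SM; rewrite raddfD /=.
  by apply: subspaceD; [|apply: IHx|apply: IHy].
- move=> x y IHx IHy n S hS SM; rewrite hcompM.
  apply: subspace_sum => // -[[|j] ltj] _ /=.
    by have [c ->] := hcomp0E x; rewrite mulr_algl; apply: subspaceZ => //; apply: IHy.
  (* The induction hypothesis for [x] is applied to the subspace of those [z] whose product with the
     fixed component of [y] lies in [S]. *)
  apply: (IHx j (fun z => S (z * hcomp (n.+1 - j.+1) y))).
    split=> [|c u v Su Sv]; first by rewrite mul0r; case: hS.
    by rewrite mulrDl -scalerAl; apply: hS.2.
  move=> a b Ga Gb; rewrite -mulrA; apply: SM => //.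
  have := homogM cA Gb (hcomp_homog cA (n.+1 - j.+1) y).
  by rewrite (_ : (j + (n.+1 - j.+1))%N = n) //; lia.
- move=> c x IHx n S hS SM; rewrite linearZ /=.
  by apply: subspaceZ => //; apply: IHx.
move=> x Gx [|n] S hS SM; rewrite (hcomp_of_homog _ _ Gx) //=.
  by rewrite -[x]mulr1; apply: SM => //; exact: homog1.
by case: hS.
Qed.

(** Products of generators of A_1 with a spanning list of A_n span A_{n+1}. *)
Lemma homog_finite n : exists s, forall x, G n x -> spanned s x.
Proof.
elim: n => [|n [s sP]].
  exists [:: 1] => x; case: (cA) => _ h _ _ /h[c ->].
  apply: (subspaceZ _ (subspace_spanned _)).
  by apply: mem_spanned; rewrite inE.
have [m [v vP]] : exists (m : nat) (v : 'I_m -> A),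
  forall x, G 1%N x <-> exists c : 'I_m -> k, x = \sum_(j < m) c j *: v j.
  by case: (cA).
exists [seq v j * w | j <- enum 'I_m, w <- s].
apply: homog_succ_ind; first exact: subspace_spanned.
move=> a b /vP[c ->] /sP sb; rewrite mulr_suml.
apply: (subspace_sum _ (subspace_spanned _)) => j _.
rewrite -scalerAl; apply: (subspaceZ _ (subspace_spanned _)).
apply: (sb (fun b => spanned _ (v j * b))).
  split=> [|d x y hx hy].
    by rewrite mulr0; apply: (subspace0 (subspace_spanned _)).
  by rewrite mulrDr -scalerAr; apply: (subspace_spanned _).2.
move=> w ws; apply: mem_spanned; apply: allpairs_f => //.
by rewrite mem_enum.
Qed.

Lemma deg_lt_finite n : exists m (v : 'I_m -> A),
  forall x, deg_lt cA n x <-> exists c, x = lincomb v c.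
Proof.
suff [s sP] : exists s, forall x, deg_lt cA n x -> spanned s x.
  (* Truncating the spanning vectors keeps every combination in degrees below [n], as the converse
     direction requires. *)
  exists (size s), (fun j => trunc cA n s`_j) => x; split=> [hx|[c ->]].
    have [c xE] := spanned_lincomb (sP x hx); exists c.
    rewrite -(trunc_id hx) {1}xE linear_sum; apply: eq_bigr => j _.
    by rewrite linearZ.
  apply: (subspace_sum _ (deg_lt_subspace _ _)) => j _.
  by apply: (subspaceZ _ (deg_lt_subspace _ _)); apply: trunc_deg_lt.
suff [s sP] : exists s, forall x, spanned s (trunc cA n x).
  by exists s => x /trunc_id <-.
elim: n => [|n [s sP]].
  exists [::] => x; rewrite /trunc big_ord0.
  exact: (subspace0 (subspace_spanned _)).
have [s' s'P] := homog_finite n; exists (s ++ s') => x.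
rewrite /trunc big_ord_recr /=.
apply: (subspaceD (subspace_spanned _)).
  apply: sP => [|y ys]; first exact: subspace_spanned.
  by apply: mem_spanned; rewrite mem_cat ys.
apply: s'P (hcomp_homog _ _ _) _ _ _ => [|y ys]; first exact: subspace_spanned.
by apply: mem_spanned; rewrite mem_cat ys orbT.
Qed.

End Generation.

(** * The filtration pulled back along a homomorphism *)

Section Lift.
Variables (k : fieldType) (C D : algType k).
Variables (G : nat -> C -> Prop) (H : nat -> D -> Prop).
Hypotheses (cC : cgfg1 G) (cD : cgfg1 H).
Variable psi : {lrmorphism D -> C}.

(** For [psi] inverse to phi this is M_n = phi(C_{>= n}). As a preimage it can be formed in both
    directions of the isomorphism. *)
Definition pullback_ge n (d : D) : Prop := deg_ge cC n (psi d).

Lemma pullback_ge_subspace n : subspace (pullback_ge n).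
Proof.
split=> [|c x y hx hy]; rewrite /pullback_ge ?raddf0 ?linearP.
  by case: (deg_ge_subspace cC n).
by apply: (deg_ge_subspace cC n).2.
Qed.

Lemma pullback_geM m n x y :
  pullback_ge m x -> pullback_ge n y -> pullback_ge (m + n) (x * y).
Proof. by move=> hx hy; rewrite /pullback_ge rmorphM; apply: deg_geM. Qed.

Lemma pullback_geW m n x : (m <= n)%N -> pullback_ge n x -> pullback_ge m x.
Proof. exact: deg_geW. Qed.

(** In degree 1, subtracting the constant term of [psi u] moves [u] into M_1. Approximations [e] of
    [a] and [f] of [b] multiply, because e f - a b = (e - a) f + a (f - b) has lower degree, and
    D_{n+1} is spanned by such products. *)
Lemma homog_fil n u : H n u -> exists e, pullback_ge n e /\ deg_lt cD n (e - u).
Proof.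
elim: n u => [u Hu|n IHn].
  exists u; rewrite subrr; split=> [//|].
  by apply: (subspace0 (deg_lt_subspace cD 0)).
have fil1 u : H 1%N u -> exists e, pullback_ge 1 e /\ deg_lt cD 1 (e - u).
  move=> Hu; have [c cE] := hcomp0E cC (psi u).
  exists (u - c%:A); split.
    case=> // _; rewrite rmorphB /= linearZ rmorph1 raddfB /= cE.
    by rewrite (hcomp_of_homog _ _ (homog_scalar cC c)) subrr.
  rewrite addrAC subrr add0r -scaleNr.
  exact: homog_deg_lt (homog_scalar cD _).
apply: homog_succ_ind => //.
  split=> [|c u v [e [he eu]] [f [hf fv]]].
    exists 0; rewrite subrr; split; first exact: (subspace0 (pullback_ge_subspace _)).
    exact: (subspace0 (deg_lt_subspace _ _)).
  exists (c *: e + f); split; first exact: (pullback_ge_subspace _).2.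
  rewrite opprD addrACA -scalerBr; exact: (deg_lt_subspace _ _).2.
move=> a b /[dup] Ha /fil1[e [he ea]] /[dup] Hb /IHn[f [hf fb]].
exists (e * f); split; first exact: (pullback_geM he hf).
have -> : e * f - a * b = (e - a) * f + a * (f - b).
  by rewrite mulrBl mulrBr addrA subrK.
apply: (subspaceD (deg_lt_subspace _ _)).
  apply: (@deg_ltM' _ _ _ _ 1 n) => //.
  rewrite -[f](subrK b); apply: (subspaceD (deg_lt_subspace _ _)).
    exact: deg_ltW fb.
  exact: homog_deg_lt Hb.
by apply: (@deg_ltM _ _ _ _ 1 n) => //; apply: homog_deg_lt Ha.
Qed.

Lemma deg_lt_fil_split n d : exists e, deg_lt cD n e /\ pullback_ge n (d - e).
Proof.
pose S d := exists e, deg_lt cD n e /\ pullback_ge n (d - e).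
have hS : subspace S.
  split=> [|c u v [e [he eu]] [f [hf fv]]].
    exists 0; rewrite subrr; split; first exact: (subspace0 (deg_lt_subspace _ _)).
    exact: (subspace0 (pullback_ge_subspace _)).
  exists (c *: e + f); split; first exact: (deg_lt_subspace _ _).2.
  rewrite opprD addrACA -scalerBr; exact: (pullback_ge_subspace _).2.
suff SH i u : H i u -> S u.
  rewrite -/(S d); move: d; apply: (homog_ind cD) => //; first by case: hS.
  by move=> x y; apply: subspaceD.
elim/ltn_ind: i u => i IH u Hu; have [i_n|n_i] := ltnP i n.
  exists u; rewrite subrr; split; first exact: homog_deg_lt Hu.
  by apply: (subspace0 (pullback_ge_subspace n)).
(* Write u = e - (e - u): [e] lies in M_i, inside M_n, and the components of [e - u] have degree
   below [i], where the induction hypothesis applies. *)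
have [e [he eu]] := homog_fil Hu; rewrite -[u](subKr e).
apply: subspaceB => //.
  exists 0; rewrite subr0; split; last exact: pullback_geW he.
  by apply: (subspace0 (deg_lt_subspace cD n)).
have [m [m0 ->]] := hcomp_sum cD (e - u).
apply: subspace_sum => // j _; have [ij|ji] := leqP i j.
  by rewrite eu //; case: hS.
by apply: (IH j) => //; apply: hcomp_homog.
Qed.

End Lift.

(** * From an ungraded to a graded isomorphism *)

Section Isomorphism.
Variables (k : fieldType) (C D : algType k).
Variables (G : nat -> C -> Prop) (H : nat -> D -> Prop).
Hypotheses (cC : cgfg1 G) (cD : cgfg1 H).
Variables (phi : {lrmorphism C -> D}) (psi : {lrmorphism D -> C}).
Hypotheses (phiK : cancel phi psi) (psiK : cancel psi phi).
Local Notation fil := (pullback_ge cC psi).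

(** The dimension count takes the form of an endomorphism [T] of D_{< n}, passing through C_{< n}
    and back. It is onto by the two splittings, hence injective, and it kills whatever lies in
    M_n. *)
Lemma deg_lt_fil_eq0 n d : deg_lt cD n d -> fil n d -> d = 0.
Proof.
move=> hd fd; have [m [v vP]] := deg_lt_finite cD n.
pose T : {linear D -> D} := trunc cD n \o phi \o trunc cC n \o psi.
apply: (surjective_endo_injective (T := T) vP _ _ hd).
- by move=> x _; apply: trunc_deg_lt.
- move=> x hx.
  (* Split [psi x] to get [c] in C_{< n}, then [phi c] to get [e] in D_{< n}. The discarded parts
     vanish under truncation on the other side, so [T] sends [e] to [x]. *)
  have [c [hc fc]] := deg_lt_fil_split cD cC phi n (psi x).
  have [e [he fe]] := deg_lt_fil_split cC cD psi n (phi c).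
  exists e => //=.
  have -> : trunc cC n (psi e) = c.
    move/trunc_eq0: fe; rewrite rmorphB /= phiK raddfB /= (trunc_id hc).
    by move/eqP; rewrite subr_eq0 => /eqP.
  move/trunc_eq0: fc; rewrite rmorphB /= psiK raddfB /= (trunc_id hx).
  by move/eqP; rewrite subr_eq0 => /eqP.
by rewrite /= (trunc_eq0 fd) !raddf0.
Qed.

(* Writing M_n for [fil n], this relates [x] in C_n to [u] in D_n when they
   correspond under C_n ~ M_n / M_{n+1} ~ D_n; the second isomorphism takes top
   components in the complement D_{<= n} of M_{n+1}. *)
Definition symbol n (x : C) (u : D) : Prop :=
  exists d, [/\ deg_lt cD n.+1 d, fil n.+1 (phi x - d) & hcomp cD n d = u].

Lemma homog_deg_ge_fil n x : G n x -> fil n (phi x).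
Proof. by rewrite /pullback_ge phiK; apply: homog_deg_ge. Qed.

Lemma symbol_linear n c x y u v :
  symbol n x u -> symbol n y v -> symbol n (c *: x + y) (c *: u + v).
Proof.
move=> [d [hd fd <-]] [e [he fe <-]]; exists (c *: d + e); split.
- exact: (deg_lt_subspace _ _).2.
- rewrite linearP opprD addrACA -scalerBr; exact: (pullback_ge_subspace _ _ _).2.
by rewrite linearP.
Qed.

Lemma symbol0 n : symbol n 0 0.
Proof.
exists 0; rewrite !raddf0 addr0; split=> //.
  exact: (subspace0 (deg_lt_subspace _ _)).
exact: (subspace0 (pullback_ge_subspace _ _ _)).
Qed.

Lemma symbolD n x y u v : symbol n x u -> symbol n y v -> symbol n (x + y) (u + v).
Proof. by move=> xu yv; rewrite -[x]scale1r -[u]scale1r; apply: symbol_linear. Qed.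

Lemma symbol_total n x : exists u, symbol n x u.
Proof.
have [d [hd fd]] := deg_lt_fil_split cC cD psi n.+1 (phi x).
by exists (hcomp cD n d), d.
Qed.

Lemma symbol_homog n x u : symbol n x u -> H n u.
Proof. by move=> [d [_ _ <-]]; apply: hcomp_homog. Qed.

(** If x = 0, the representative lies in D_{<= n} and M_{n+1}, which meet in 0. If u = 0, it lies in
    D_{< n} and M_n, which also meet in 0, so [x] has components only above [n]. *)
Lemma symbol_eq0 n x u : G n x -> symbol n x u -> x = 0 <-> u = 0.
Proof.
move=> Gx [d [hd fd <-]]; split=> [x0|d0].
  rewrite (_ : d = 0) ?raddf0 //; apply: deg_lt_fil_eq0 hd _.
  rewrite -[d]opprK -[- d]add0r -(raddf0 phi) -x0 -scaleN1r.
  exact: (subspaceZ _ (pullback_ge_subspace _ _ _)).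
have d_lt : deg_lt cD n d by move=> j; rewrite leq_eqVlt => /predU1P[<-|/hd].
have d_fil : fil n d.
  rewrite -[d](subKr (phi x)); apply: (subspaceB (pullback_ge_subspace _ _ _)).
    exact: homog_deg_ge_fil.
  exact: pullback_geW fd.
move: fd; rewrite (deg_lt_fil_eq0 d_lt d_fil) subr0 /pullback_ge phiK => fx.
by apply: deg_lt_ge_eq0 fx; apply: homog_deg_lt Gx.
Qed.

(** Approximate [u] by [e] in M_n with top component [u]; the lowest possible component of [psi e],
    in degree [n], is the required [x]. *)
Lemma symbol_surj n u : H n u -> exists2 x, G n x & symbol n x u.
Proof.
move=> Hu; have [e [fe eu]] := homog_fil cC cD psi Hu.
exists (hcomp cC n (psi e)); first exact: hcomp_homog.
exists e; split.
- rewrite -[e](subrK u); apply: (subspaceD (deg_lt_subspace _ _)).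
    exact: deg_ltW eu.
  exact: homog_deg_lt Hu.
- rewrite /pullback_ge rmorphB /= phiK => j; rewrite ltnS raddfB /=.
  rewrite (hcomp_of_homog _ _ (hcomp_homog _ _ _)).
  rewrite leq_eqVlt => /predU1P[->|jn]; first by rewrite eqxx subrr.
  by rewrite (fe j jn) ltn_eqF // subrr.
apply/eqP; rewrite -subr_eq0 -[X in _ - X](_ : hcomp cD n u = u).
  by rewrite -raddfB /= eu.
by rewrite (hcomp_of_homog _ _ Hu) eqxx.
Qed.

(** The product of representatives represents the product: the error (phi x - d) phi y + d (phi y -
    e) lies in M_{m+n+1}, and top components multiply. *)
Lemma symbolM m n x y u v : G m x -> G n y ->
  symbol m x u -> symbol n y v -> symbol (m + n) (x * y) (u * v).
Proof.
move=> Gx Gy [d [hd fd <-]] [e [he fe <-]]; exists (d * e); split.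
- by rewrite -addnS; apply: deg_ltM.
- have -> : phi (x * y) - d * e = (phi x - d) * phi y + d * (phi y - e).
    by rewrite rmorphM mulrBl mulrBr addrA subrK.
  apply: (subspaceD (pullback_ge_subspace _ _ _)).
    by rewrite -addSn; apply: pullback_geM fd _; apply: homog_deg_ge_fil.
  rewrite -addnS; apply: pullback_geM fe.
  rewrite -[d](subKr (phi x)); apply: (subspaceB (pullback_ge_subspace _ _ _)).
    exact: homog_deg_ge_fil.
  exact: pullback_geW fd.
exact: hcomp_topM.
Qed.

Lemma symbol1 : symbol 0 1 1.
Proof.
exists 1; rewrite rmorph1 subrr; split.
- exact: homog_deg_lt (homog1 cD).
- exact: (subspace0 (pullback_ge_subspace _ _ _)).
by rewrite (hcomp_of_homog _ _ (homog1 cD)).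
Qed.

(** The graph of C ~ gr_M D ~ D, assembled degree by degree. It stays a relation until totality,
    surjectivity and compatibility with equality are known; [choice] then yields the maps. *)
Definition gr_rel x u : Prop := forall n, symbol n (hcomp cC n x) (hcomp cD n u).

Lemma gr_rel_linear c x y u v :
  gr_rel x u -> gr_rel y v -> gr_rel (c *: x + y) (c *: u + v).
Proof. by move=> xu yv n; rewrite !linearP; apply: symbol_linear. Qed.

Lemma gr_rel_homog n x u : G n x -> symbol n x u -> gr_rel x u.
Proof.
move=> Gx xu j; rewrite (hcomp_of_homog _ _ Gx).
rewrite (hcomp_of_homog _ _ (symbol_homog xu)).
by case: eqP => [->|_] //; apply: symbol0.
Qed.

Lemma gr_relD x y u v : gr_rel x u -> gr_rel y v -> gr_rel (x + y) (u + v).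
Proof. by move=> xu yv n; rewrite !raddfD; apply: symbolD. Qed.

Lemma gr_rel0 : gr_rel 0 0.
Proof. by move=> n; rewrite !raddf0; apply: symbol0. Qed.

Lemma gr_rel_total x : exists u, gr_rel x u.
Proof.
move: x; apply: (homog_ind cC) => [|x y [u xu] [v yv]|n x Gx].
- by exists 0; apply: gr_rel0.
- by exists (u + v); apply: gr_relD.
by have [u xu] := symbol_total n x; exists u; apply: gr_rel_homog Gx xu.
Qed.

Lemma gr_rel_surj u : exists x, gr_rel x u.
Proof.
move: u; apply: (homog_ind cD) => [|u v [x xu] [y yv]|n u /symbol_surj[x Gx xu]].
- by exists 0; apply: gr_rel0.
- by exists (x + y); apply: gr_relD.
by exists x; apply: gr_rel_homog Gx xu.
Qed.

Lemma gr_rel_hcomp_eq0 n x u : gr_rel x u -> hcomp cC n x = 0 <-> hcomp cD n u = 0.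
Proof. by move=> /(_ n); apply: symbol_eq0; apply: hcomp_homog. Qed.

Lemma gr_rel_eq0 x u : gr_rel x u -> x = 0 <-> u = 0.
Proof.
move=> xu; split=> e0.
  apply: (hcomp_inj (hG := cD)) => n.
  by rewrite [RHS]raddf0; apply/(gr_rel_hcomp_eq0 n xu); rewrite e0 raddf0.
apply: (hcomp_inj (hG := cC)) => n.
by rewrite [RHS]raddf0; apply/(gr_rel_hcomp_eq0 n xu); rewrite e0 raddf0.
Qed.

Lemma gr_rel_eq x y u v : gr_rel x u -> gr_rel y v -> x = y <-> u = v.
Proof.
move=> xu yv; have /gr_rel_eq0[h1 h2] := gr_rel_linear (-1) xu yv.
rewrite !scaleN1r in h1 h2; split=> [xy|uv].
  by apply/eqP; rewrite eq_sym -subr_eq0 addrC h1 // xy addNr.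
by apply/eqP; rewrite eq_sym -subr_eq0 addrC h2 // uv addNr.
Qed.

Lemma gr_relM x y u v : gr_rel x u -> gr_rel y v -> gr_rel (x * y) (u * v).
Proof.
move=> xu yv n; rewrite !hcompM.
elim/big_ind2: _ => [|? ? ? ?|j _]; [exact: symbol0 | exact: symbolD |].
have := symbolM (hcomp_homog _ _ _) (hcomp_homog _ _ _) (xu j) (yv (n - j)%N).
by rewrite subnKC // -ltnS.
Qed.

Lemma gr_rel_graded n x u : gr_rel x u -> G n x <-> H n u.
Proof.
move=> xu; split=> h.
  apply: (homog_of_hcomp (hG := cD)) => j jn; apply/(gr_rel_hcomp_eq0 j xu).
  by rewrite (hcomp_of_homog _ _ h) (negPf jn).
apply: (homog_of_hcomp (hG := cC)) => j jn; apply/(gr_rel_hcomp_eq0 j xu).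
by rewrite (hcomp_of_homog _ _ h) (negPf jn).
Qed.

Lemma graded_iso_of_iso : exists g : C -> D, graded_iso G H g.
Proof.
have [g gP] := choice gr_rel_total; have [h hP] := choice gr_rel_surj.
exists g; split=> [|n x]; last exact: gr_rel_graded.
have gE x u : gr_rel x u -> g x = u by move=> xu; apply/(gr_rel_eq (gP x) xu).
have gr1 : gr_rel 1 1 := gr_rel_homog (homog1 cC) symbol1.
split.
- exists h => [x|u]; first by apply/(gr_rel_eq (hP (g x)) (gP x)).
  exact: gE.
- by move=> x y; apply/gE/gr_relD.
- by move=> x y; apply/gE/gr_relM.
- exact: gE.
by move=> c; apply: gE; rewrite -[c%:A]addr0 -[X in gr_rel _ X]addr0;
  apply: gr_rel_linear gr_rel0.
Qed.

End Isomorphism.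

(** Preserving scalars and products gives k-linearity, since c x = (c 1) x; the inverse inherits all
    properties by injectivity. *)
Lemma kalg_iso_lrmorphism (k : fieldType) (C D : algType k) (f : C -> D) :
    kalg_iso (fun c : k => c%:A : C) (fun c : k => c%:A : D) f ->
  exists (F : {lrmorphism C -> D}) (F' : {lrmorphism D -> C}),
    [/\ cancel F F', cancel F' F & F =1 f].
Proof.
move=> [[f' fK f'K] fD fM f1 fA].
have fZ (c : k) x : f (c *: x) = c *: f x.
  by rewrite -mulr_algl fM fA mulr_algl.
have f_lin : linear f by move=> c x y; rewrite fD fZ.
have f'_lin : linear f'.
  by move=> c x y; apply: (can_inj fK); rewrite f_lin !f'K.
have f'M : monoid_morphism f'.
  split=> [|x y]; apply: (can_inj fK); last by rewrite fM !f'K.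
  by rewrite f'K; apply/esym/f1.
pose F := HB.pack_for {lrmorphism C -> D} f
  (GRing.isLinear.Build k C D *:%R f f_lin)
  (GRing.isMonoidMorphism.Build C D f (conj f1 fM)).
pose F' := HB.pack_for {lrmorphism D -> C} f'
  (GRing.isLinear.Build k D C *:%R f' f'_lin)
  (GRing.isMonoidMorphism.Build D C f' f'M).
by exists F, F'.
Qed.

(** * Polynomial algebras over k and their total-degree grading *)

(* [{poly R}] is in the library an algebra over [R] only, not over [k]. *)
Definition polyk (k : fieldType) (R : algType k) : Type := {poly R}.
HB.instance Definition _ (k : fieldType) (R : algType k) :=
  GRing.NzRing.on (polyk R).

Section PolynomialAlgebra.
Variables (k : fieldType) (R : algType k).
Implicit Types (p q : polyk R) (c d : k).

Definition polyk_scale c p : polyk R := (c%:A : R) *: (p : {poly R}).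

Lemma coef_polyk_scale c p i : (polyk_scale c p : {poly R})`_i = c *: p`_i.
Proof. by rewrite coefZ mulr_algl. Qed.

Lemma polyk_scaleA c d p :
  polyk_scale c (polyk_scale d p) = polyk_scale (c * d) p.
Proof. by apply/polyP=> i; rewrite !coef_polyk_scale scalerA. Qed.

Lemma polyk_scale1 : left_id 1 polyk_scale.
Proof. by move=> p; apply/polyP=> i; rewrite !coef_polyk_scale scale1r. Qed.

Lemma polyk_scaleDr : right_distributive polyk_scale +%R.
Proof.
by move=> c p q; apply/polyP=> i; rewrite coefD !coef_polyk_scale coefD scalerDr.
Qed.

Lemma polyk_scaleDl p : {morph polyk_scale^~ p : c d / c + d}.
Proof.
by move=> c d; apply/polyP=> i; rewrite coefD !coef_polyk_scale scalerDl.
Qed.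

HB.instance Definition _ := GRing.Zmodule_isLmodule.Build k (polyk R)
  polyk_scaleA polyk_scale1 polyk_scaleDr polyk_scaleDl.

Lemma coef_scalek c p i : (c *: p : {poly R})`_i = c *: p`_i.
Proof. exact: coef_polyk_scale. Qed.

Lemma polyk_scaleAl c p q : c *: (p * q) = (c *: p) * q.
Proof. exact: scalerAl. Qed.

HB.instance Definition _ :=
  GRing.Lmodule_isLalgebra.Build k (polyk R) polyk_scaleAl.

Lemma polyk_scaleAr c p q : c *: (p * q) = p * (c *: q).
Proof.
apply/polyP=> i; rewrite coef_scalek !coefM scaler_sumr; apply: eq_bigr => j _.
by rewrite coef_scalek scalerAr.
Qed.

HB.instance Definition _ :=
  GRing.Lalgebra_isAlgebra.Build k (polyk R) polyk_scaleAr.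

Definition constk (a : R) : polyk R := a%:P.
Definition coef0k (p : polyk R) : R := p`_0.

Lemma constk_is_linear : linear constk.
Proof.
by move=> c a b; apply/polyP=> i; rewrite coefD coef_scalek !coefC; case: i => [|i];
  rewrite ?scaler0 ?addr0.
Qed.

Lemma constk_is_monoid_morphism : monoid_morphism constk.
Proof. by split=> [|a b]; rewrite /constk ?polyC1 ?polyCM. Qed.

HB.instance Definition _ :=
  GRing.isLinear.Build k R (polyk R) *:%R constk constk_is_linear.
HB.instance Definition _ :=
  GRing.isMonoidMorphism.Build R (polyk R) constk constk_is_monoid_morphism.

Lemma coef0k_is_linear : linear coef0k.
Proof. by move=> c p q; rewrite /coef0k coefD coef_scalek. Qed.

Lemma coef0k_is_monoid_morphism : monoid_morphism coef0k.
Proof.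
by split=> [|p q]; rewrite /coef0k ?coef1 // coefM big_ord_recl big_ord0 addr0.
Qed.

HB.instance Definition _ :=
  GRing.isLinear.Build k (polyk R) R *:%R coef0k coef0k_is_linear.
HB.instance Definition _ :=
  GRing.isMonoidMorphism.Build (polyk R) R coef0k coef0k_is_monoid_morphism.

Variable G : nat -> R -> Prop.

(** Total degree with X in degree 1. The test [j <= i] guards against truncated subtraction, which
    would admit scalar coefficients beyond X^i. *)
Definition poly_grading i (p : polyk R) : Prop :=
  forall j, if (j <= i)%N then G (i - j) p`_j else p`_j = 0.

Hypothesis cR : cgfg1 G.

Lemma poly_grading_subspace i : subspace (poly_grading i).
Proof.
split=> [j|c p q hp hq j].
  by rewrite coef0; case: ifP => // _; exact: (homog0 cR).
rewrite coefD coef_scalek; move: (hp j) (hq j); case: ifP => _ hpj hqj.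
  exact: (homog_subspace cR _).2.
by rewrite hpj hqj scaler0 addr0.
Qed.

Lemma poly_gradingM i j p q :
  poly_grading i p -> poly_grading j q -> poly_grading (i + j) (p * q).
Proof.
move=> hp hq l; rewrite coefM; case: leqP => lij.
  apply: (subspace_sum _ (homog_subspace cR _)) => m _.
  have := ltn_ord m; rewrite ltnS => ml; move: (hp m) (hq (l - m)%N).
  case: leqP => mi; last by move=> -> _; rewrite mul0r; exact: (homog0 cR).
  case: leqP => lmj; last by move=> _ ->; rewrite mulr0; exact: (homog0 cR).
  by move=> h1 /(homogM cR h1); rewrite (_ : (_ + _)%N = (i + j - l)%N) //; lia.
rewrite big1 // => m _; have := ltn_ord m; rewrite ltnS => ml.
move: (hp m) (hq (l - m)%N); case: leqP => mi; last by move=> ->; rewrite mul0r.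
by case: leqP => lmj; [lia | move=> _ ->; rewrite mulr0].
Qed.

Lemma poly_grading_const i a : G i a -> poly_grading i (constk a).
Proof.
move=> Ga [|j]; rewrite coefC //= ?subn0 //.
by case: ifP => // _; exact: (homog0 cR).
Qed.

Lemma poly_gradingX : poly_grading 1 ('X : {poly R}).
Proof.
move=> [|[|j]]; rewrite coefX //=; first exact: (homog0 cR).
exact: (homog1 cR).
Qed.

Lemma poly_gradingMX i p : poly_grading i p -> poly_grading i.+1 (p * ('X : {poly R})).
Proof. by move=> hp; rewrite -addn1; apply: poly_gradingM poly_gradingX. Qed.

Lemma poly_grading_decomposition p : exists n (f : nat -> polyk R),
  (forall i, poly_grading i (f i)) /\ p = \sum_(i < n) f i.
Proof.
elim/poly_ind: p => [|p a [n [f [hf ->]]]].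
  exists 0%N, (fun=> 0); rewrite big_ord0; split=> // i.
  exact: (subspace0 (poly_grading_subspace i)).
have [m [a0 aE]] := hcomp_sum cR a.
(* Multiplication by X shifts the components of [p] up by one; the cutoff is there because [f] is
   arbitrary from index [n] on. *)
pose h i : polyk R :=
  if (i < n.+1)%N then if i is j.+1 then f j * ('X : {poly R}) else 0 else 0.
exists (n.+1 + m)%N, (fun i => h i + constk (hcomp cR i a)); split=> [i|].
  apply: (subspaceD (poly_grading_subspace i)); last first.
    by apply: poly_grading_const; exact: hcomp_homog.
  rewrite /h; case: ifP => _; last exact: (subspace0 (poly_grading_subspace i)).
  case: i => [|i]; last exact: poly_gradingMX.
  exact: (subspace0 (poly_grading_subspace 0)).
rewrite big_split /= -raddf_sum -(@sum_widen _ _ h n.+1) ?leq_addr //; last first.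
  by move=> i ni; rewrite /h ltnNge ni.
rewrite -(@sum_widen _ _ (fun i => hcomp cR i a) m) ?leq_addl // -aE.
rewrite big_ord_recl {1}/h /= add0r; congr (_ + _).
by rewrite mulr_suml; apply: eq_bigr => i _; rewrite /h /= ltnS ltn_ord.
Qed.

Lemma poly_grading_independent n (f : nat -> polyk R) :
    (forall i, poly_grading i (f i)) -> \sum_(i < n) f i = 0 ->
  forall i, (i < n)%N -> f i = 0.
Proof.
move=> hf f0 i i_n; apply/polyP=> j; rewrite coef0.
have := hf i j; case: leqP => // ji _.
have [_ _ _ _ indep] := cgfg1_grading cR.
(* Compare coefficients of X^j: components of degree below [j] contribute nothing, and after
   shifting the index by [j] the coefficient at [l] is homogeneous of degree [l]. *)
rewrite -(subnK ji); apply: (indep (n - j)%N (fun l => (f (l + j)%N)`_j)); last by lia.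
  by move=> l; have := hf (l + j)%N j; rewrite leq_addl addnK.
have -> : \sum_(l < n - j) (f (l + j)%N)`_j = \sum_(0 <= l < n) (f l)`_j.
  rewrite (@big_cat_nat _ _ _ j 0 n) //=; last by lia.
  have -> : \sum_(0 <= l < j) (f l)`_j = 0.
    rewrite big_nat_cond big1 // => l /andP[/andP[_ lj] _].
    by have := hf l j; rewrite leqNgt lj.
  rewrite add0r.
  transitivity (\sum_(0 + j <= l < n) (f l)`_j); last by rewrite add0n.
  by rewrite big_addn big_mkord.
by rewrite big_mkord -coef_sum; have -> := f0; rewrite coef0.
Qed.

Lemma cgfg1_poly : cgfg1 poly_grading.
Proof.
split.
- split.
  + by move=> i; apply: (subspace0 (poly_grading_subspace i)).
  + split=> i; first by move=> p q; apply: (subspaceD (poly_grading_subspace i)).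
    by move=> c p; apply: (subspaceZ _ (poly_grading_subspace i)).
  + exact: poly_gradingM.
  + exact: poly_grading_decomposition.
  + exact: poly_grading_independent.
- move=> p; split=> [hp|[c ->]]; last first.
    apply: (subspaceZ _ (poly_grading_subspace 0)).
    rewrite -(rmorph1 constk); apply: poly_grading_const; exact: (homog1 cR).
  have [_ G0 _ _] := cR; have /G0[c cE] := hp 0%N.
  exists c; apply/polyP=> i; rewrite coef_scalek coef1.
  case: i => [|i]; first by rewrite cE.
  by rewrite scaler0; apply: (hp i.+1).
- have [_ G0 [m [v vP]] _] := cR.
  exists m.+1.
  (* Degree 1 is spanned by X, at index 0, and the constants from degree 1 of [R]. *)
  exists (fun i => if unlift ord0 i is Some j then constk (v j) else ('X : polyk R)).
  move=> p; split=> [hp|[c ->]].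
    have /vP[c cE] := hp 0%N; have /G0[d dE] := hp 1%N.
    exists (fun i => if unlift ord0 i is Some j then c j else d).
    rewrite big_ord_recl unlift_none.
    under eq_bigr do rewrite liftK -linearZ /=.
    rewrite -raddf_sum -cE; apply/polyP=> i.
    rewrite coefD coef_scalek coefX coefC; case: i => [|[|i]] /=.
    - by rewrite scaler0 add0r.
    - by rewrite dE addr0.
    by rewrite scaler0 add0r; apply: (hp i.+2).
  apply: (subspace_sum _ (poly_grading_subspace 1)) => i _.
  apply: (subspaceZ _ (poly_grading_subspace 1)).
  case: unlift => [j|]; last exact: poly_gradingX.
  apply: poly_grading_const; apply/vP; exists (fun i => (i == j)%:R).
  rewrite (bigD1 j) //= eqxx scale1r big1 ?addr0 // => l /negPf->.
  by rewrite scale0r.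
move=> P P1 PD PM PZ P_1.
have Pconst a : P (constk a).
  have [_ _ _ genR] := cR; move: a; apply: genR.
  - by rewrite rmorph1.
  - by move=> a b Pa Pb; rewrite raddfD; apply: PD.
  - by move=> a b Pa Pb; rewrite rmorphM; apply: PM.
  - by move=> c a Pa; rewrite linearZ; apply: PZ.
  by move=> a Ga; apply/P_1/poly_grading_const.
elim/poly_ind => [|p a Pp]; first by rewrite -(raddf0 constk).
by apply: PD => //; apply: PM => //; apply/P_1/poly_gradingX.
Qed.

End PolynomialAlgebra.

(** * Iterated polynomial extensions and their variables *)

(* [C] looks like [A[t_1, ..., t_n]], graded with every [t_j] in degree 1. *)
Record central_extension (k : fieldType) (A C : algType k)
    (GA : nat -> A -> Prop) (GC : nat -> C -> Prop) (n : nat)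
    (iota : {lrmorphism A -> C}) (pi : {lrmorphism C -> A}) (t : 'I_n -> C) : Prop := {
  iotaK : cancel iota pi;
  iota_homog : forall i x, GA i x -> GC i (iota x);
  pi_homog : forall i x, GC i x -> GA i (pi x);
  t_homog : forall j, GC 1%N (t j);
  t_central : forall j x, t j * x = x * t j;
  pi_t : forall j, pi (t j) = 0;
  t_free : forall c, lincomb t c = 0 -> c = 0;
  t_span : forall z, GC 1%N z -> pi z = 0 -> exists c, z = lincomb t c;
  t_quotient : forall (E : algType k) (h : {lrmorphism C -> E}),
    (forall j, h (t j) = 0) -> forall x, h x = h (iota (pi x))
}.

Lemma central_extension_id (k : fieldType) (A : algType k) (GA : nat -> A -> Prop)
  (t : 'I_0 -> A) : central_extension GA GA idfun idfun t.
Proof.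
split=> //= [[]|[]|[]|c _|z _ ->] //; first by apply/rowP=> -[].
by exists 0; rewrite linear0.
Qed.

(** Adjoining one variable: X becomes the variable of index 0, the earlier variables become
    constants, and the projection first takes the constant coefficient. *)
Lemma central_extension_poly (k : fieldType) (A C : algType k)
    (GA : nat -> A -> Prop) (GC : nat -> C -> Prop) (n : nat)
    (iota : {lrmorphism A -> C}) (pi : {lrmorphism C -> A}) (t : 'I_n -> C) :
    cgfg1 GC -> central_extension GA GC iota pi t ->
  central_extension GA (poly_grading GC) (@constk k C \o iota) (pi \o @coef0k k C)
    (fun i => if unlift ord0 i is Some j then constk (t j) else ('X : polyk C)).
Proof.
move=> cC ext.
set t' := fun i : 'I_n.+1 => _.
have t'E (c : 'rV[k]_n.+1) : lincomb t' c =
    c 0 0 *: ('X : polyk C) + constk (lincomb t (\row_j c 0 (lift ord0 j))).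
  rewrite /lincomb big_ord_recl /t' unlift_none raddf_sum; congr (_ + _).
  by apply: eq_bigr => j _; rewrite liftK mxE /= linearZ.
have coef1_t' c : (lincomb t' c : {poly C})`_1 = (c 0 0)%:A.
  by rewrite t'E coefD coef_scalek coefX coefC addr0.
have coef0_t' c :
    (lincomb t' c : {poly C})`_0 = lincomb t (\row_j c 0 (lift ord0 j)).
  by rewrite t'E coefD coef_scalek coefX coefC scaler0 add0r.
split.
- by move=> x /=; rewrite /coef0k coefC /= (iotaK ext).
- by move=> i x Gx /=; apply: (poly_grading_const cC); apply: (iota_homog ext).
- by move=> i p /(_ 0%N); rewrite leq0n subn0; apply: (pi_homog ext).
- move=> i; rewrite /t'; case: unlift => [j|]; last exact: (poly_gradingX cC).
  by apply: (poly_grading_const cC); apply: (t_homog ext).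
- move=> i p; rewrite /t'; case: unlift => [j|]; last exact/esym/commr_polyX.
  apply/polyP=> l; rewrite coefCM coefMC; exact: (t_central ext).
- move=> i; rewrite /t' /= /coef0k; case: unlift => [j|].
    by rewrite coefC /= (pi_t ext).
  by rewrite coefX raddf0.
- move=> c c0; have := coef0_t' c; have := coef1_t' c.
  rewrite c0 !coef0 => /esym/eqP; rewrite scaler_eq0 oner_eq0 orbF => /eqP c00.
  move=> /esym/(t_free ext)/rowP cl; apply/rowP=> i; rewrite mxE.
  case: (unliftP ord0 i) => [j ->|->] //.
  by have := cl j; rewrite !mxE.
- move=> z hz /= /(t_span ext (hz 0%N))[c cE].
  have [_ G0 _ _] := cC; have /G0[d dE] := hz 1%N.
  (* The coordinate [d] is read off the coefficient of X, a scalar, and [c] off the constant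
     coefficient. *)
  exists (\row_i (if unlift ord0 i is Some j then c 0 j else d)).
  apply/polyP=> -[|[|l]].
  + rewrite coef0_t' [LHS]cE; congr lincomb; apply/rowP=> j.
    by rewrite !mxE liftK.
  + by rewrite coef1_t' mxE unlift_none [LHS]dE.
  rewrite t'E coefD coef_scalek coefX coefC /= scaler0 addr0; exact: (hz l.+2).
move=> E h ht p.
(* On constants the claim is the one for [C]; all terms divisible by X vanish under [h]. *)
have h_const a : h (constk (iota (pi a))) = h (constk a).
  symmetry; apply: (t_quotient ext (h := h \o @constk k C)) => j.
  by have := ht (lift ord0 j); rewrite /t' liftK.
rewrite /= h_const; elim/poly_ind: p => [|p a _]; first by rewrite /coef0k coef0 raddf0.
rewrite /coef0k coefD coefMX coefC /= add0r raddfD.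
have := ht ord0; rewrite /t' unlift_none => hX.
rewrite -[RHS]add0r; congr (_ + _).
by transitivity (h p * h ('X : polyk C)); [exact: (rmorphM h) | rewrite hX mulr0].
Qed.

(** A copy of [polyext] that retains the k-algebra structure at each stage. *)
Fixpoint polyalg (k : fieldType) (A : algType k) (n : nat) : algType k :=
  if n is m.+1 then polyk (polyalg A m) else A.

Fixpoint polyalg_grading (k : fieldType) (A : algType k) (G : nat -> A -> Prop)
    (n : nat) : nat -> polyalg A n -> Prop :=
  match n return nat -> polyalg A n -> Prop with
  | 0 => G
  | m.+1 => poly_grading (polyalg_grading G (n := m))
  end.

Lemma cgfg1_polyalg (k : fieldType) (A : algType k) (G : nat -> A -> Prop) n :
  cgfg1 G -> cgfg1 (polyalg_grading G (n := n)).
Proof. by move=> cA; elim: n => //= n; apply: cgfg1_poly. Qed.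

Lemma central_extension_polyalg (k : fieldType) (A : algType k)
    (G : nat -> A -> Prop) n : cgfg1 G ->
  exists iota pi t, central_extension G (polyalg_grading G (n := n)) (n := n) iota pi t.
Proof.
move=> cA; elim: n => [|n [iota [pi [t ext]]]].
  by exists idfun, idfun, (fun=> 0); apply: central_extension_id.
do 3 eexists; apply: central_extension_poly ext.
exact: cgfg1_polyalg.
Qed.

(** For a variable [n] the two recursions do not unfold to a common ring, so the identification is
    built coefficientwise by induction. *)
Lemma polyext_polyalg (k : fieldType) (A : algType k) n :
  exists (f : {rmorphism polyext A n -> polyalg A n})
         (g : {rmorphism polyalg A n -> polyext A n}),
    [/\ cancel f g, cancel g f & forall c, f (kmapn A n c) = c%:A].
Proof.
elim: n => [|n [f [g [fK gK fA]]]]; first by exists idfun, idfun.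
exists (map_poly f), (map_poly g); split=> [p|p|c].
- by apply/polyP=> i; rewrite !coef_map /= fK.
- by apply/polyP=> i; rewrite !coef_map /= gK.
rewrite [kmapn _ _ _]/= /kmapn /= map_polyC /=; move: (fA c); rewrite /kmapn => ->.
by rewrite -[LHS]/(constk _) linearZ rmorph1.
Qed.

(** * Cancelling the variables along a graded isomorphism *)

Section Cancellation.
Variables (k : fieldType) (A B C D : algType k) (n : nat).
Variables (GA : nat -> A -> Prop) (GB : nat -> B -> Prop).
Variables (GC : nat -> C -> Prop) (GD : nat -> D -> Prop).
Variables (iA : {lrmorphism A -> C}) (pA : {lrmorphism C -> A}) (t : 'I_n -> C).
Variables (iB : {lrmorphism B -> D}) (pB : {lrmorphism D -> B}) (s : 'I_n -> D).
Hypotheses (extA : central_extension GA GC iA pA t).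
Hypotheses (extB : central_extension GB GD iB pB s).
Hypothesis centerA : forall x : A, GA 1%N x -> (forall y, x * y = y * x) -> x = 0.
Variables (g : {lrmorphism C -> D}) (g' : {lrmorphism D -> C}).
Hypotheses (gK : cancel g g') (g'K : cancel g' g).
Hypothesis g_homog : forall i x, GC i x <-> GD i (g x).

(** Since [pA] is onto, it sends central elements to central elements, here inside A_1. *)
Lemma central_degree1 z : GC 1%N z -> (forall y, z * y = y * z) -> pA z = 0.
Proof.
move=> Gz zC; apply: centerA => [|y]; first exact: (pi_homog extA).
by rewrite -(iotaK extA y) -!rmorphM zC.
Qed.

Lemma iso_s_span j : exists c, g' (s j) = lincomb t c.
Proof.
have Gs : GC 1%N (g' (s j)) by apply/g_homog; rewrite g'K; apply: (t_homog extB).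
apply: (t_span extA) => //; apply: central_degree1 => // y.
by rewrite -(gK y) -!rmorphM (t_central extB).
Qed.

Lemma pi_iso_s j : pA (g' (s j)) = 0.
Proof.
have [c ->] := iso_s_span j; rewrite /lincomb raddf_sum big1 // => i _.
by rewrite /= linearZ /= (pi_t extA) scaler0.
Qed.

(* The n independent elements [g' (s j)] of the span of the n elements [t i]
   span it. *)
Lemma pi_iso_t i : pB (g (t i)) = 0.
Proof.
have /fin_all_exists[m mE] := iso_s_span.
pose M := \matrix_j m j.
have ME c : lincomb t (c *m M) = g' (lincomb s c).
  rewrite lincomb_mulmx raddf_sum; apply: eq_bigr => j _.
  by rewrite /= linearZ /= rowK mE.
(* A row in the left kernel of [M] is a linear relation among the [g' (s j)], hence among the
   independent [s j]. *)
have M_unit : M \in unitmx.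
  rewrite -row_free_unit -kermx_eq0; apply/eqP/row_matrixP=> j; rewrite row0.
  apply: (t_free extB); apply: (can_inj g'K).
  by rewrite -ME -row_mul mulmx_ker row0 !raddf0.
have -> : t i = g' (lincomb s (delta_mx 0 i *m invmx M)).
  by rewrite -ME mulmxKV // lincomb_delta.
rewrite g'K /lincomb raddf_sum big1 // => j _.
by rewrite /= linearZ /= (pi_t extB) scaler0.
Qed.

Lemma cancellation : exists psi : A -> B, graded_iso GA GB psi.
Proof.
pose psi : {lrmorphism A -> B} := pB \o g \o iA.
pose psi' : {lrmorphism B -> A} := pA \o g' \o iB.
have psiK : cancel psi psi'.
  (* As [pA \o g'] kills every [s j], it factors through [pB]; evaluating at [g (iA a)] gives the
     inverse law. *)
  move=> a; have := t_quotient extB (h := pA \o g') pi_iso_s (g (iA a)).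
  by rewrite /= gK (iotaK extA) => <-.
have psi'K : cancel psi' psi.
  move=> b; have := t_quotient extA (h := pB \o g) pi_iso_t (g' (iB b)).
  by rewrite /= g'K (iotaK extB) => <-.
exists psi; split=> [|i x].
  split; [by exists psi' | exact: raddfD | exact: rmorphM | exact: rmorph1 |].
  by move=> c; rewrite linearZ rmorph1.
split=> [Gx|/(iota_homog extB) Gx].
  by apply/(pi_homog extB)/g_homog/(iota_homog extA).
rewrite -(psiK x); apply: (pi_homog extA); apply/g_homog.
by rewrite /= g'K.
Qed.

End Cancellation.

Theorem theorem3p1 (k : fieldType) (A B : algType k)
    (GA : nat -> A -> Prop) (GB : nat -> B -> Prop) (n : nat) :
  cgfg1 GA -> cgfg1 GB ->
  (* Z(A) ∩ A_1 = {0} *)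
  (forall x : A, GA 1%N x -> (forall y : A, x * y = y * x) -> x = 0) ->
  (* A[t_1..t_n] ≅ B[s_1..s_n] as ungraded k-algebras *)
  (exists phi : polyext A n -> polyext B n, kalg_iso (kmapn A n) (kmapn B n) phi) ->
  (* A ≅ B *)
  exists psi : A -> B, graded_iso GA GB psi.
Proof.
move=> cA cB centerA [phi [phi_bij phiD phiM phi1 phi_k]].
have [fA [gA [fAK gAK fA_k]]] := polyext_polyalg A n.
have [fB [gB [fBK gBK fB_k]]] := polyext_polyalg B n.
have gA_k c : gA c%:A = kmapn A n c by rewrite -fA_k fAK.
(* Transport [phi] to the copies that carry a k-algebra structure and a grading. *)
have iso : kalg_iso (fun c : k => c%:A : polyalg A n)
    (fun c : k => c%:A : polyalg B n) (fB \o phi \o gA).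
  split=> [|x y|x y||c] /=; rewrite ?raddfD ?phiD ?rmorphD ?rmorphM ?phiM //.
  - apply: bij_comp; last by exists fA.
    by apply: bij_comp => //; exists gB.
  - by rewrite rmorphM.
  - by rewrite rmorph1 phi1 rmorph1.
  by rewrite gA_k phi_k fB_k.
have [Phi [Psi [PhiK PsiK _]]] := kalg_iso_lrmorphism iso.
have cC := cgfg1_polyalg n cA; have cD := cgfg1_polyalg n cB.
have [g [/kalg_iso_lrmorphism[g1 [g2 [g1K g2K g1E]]] g_homog]] :=
  graded_iso_of_iso cC cD PhiK PsiK.
have [iA [pA [t extA]]] := central_extension_polyalg n cA.
have [iB [pB [s extB]]] := central_extension_polyalg n cB.
apply: (cancellation extA extB centerA g1K g2K) => i x.
by rewrite g1E.
Qed.
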